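(* Let $\zeta\in\mathbb{C}$ be a primitive third root of unity, let $e_0,e_1,e_2,e_3$ be the standard basis of $\mathbb{C}^4$, and let $$S=\{\,[e_i-\zeta^a e_j]\;\mid\; i\in\{0,1\},\ j\in\{2,3\},\ a\in\mathbb{Z}/3\mathbb{Z}\,\}\subset\mathbb{P}^3_{\mathbb{C}}.$$ Then the number of planes spanned by $S$ is $$f_2(S)=43.$$
   Context: $[v]$ denotes the point of $\mathbb{P}^3_{\mathbb{C}}=\mathbb{P}(\mathbb{C}^4)$ represented by a nonzero vector $v\in\mathbb{C}^4$. For a finite set $S\subset\mathbb{P}^3_{\mathbb{C}}$, $f_2(S)$ denotes the number of distinct planes in $\mathbb{P}^3_{\mathbb{C}}$ spanned by triples of non-collinear points of $S$. *)

(* Defs.v *)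
From HB Require Import structures.
From mathcomp Require Import all_boot all_order all_algebra.
From mathcomp Require Import finmap.
From mathcomp Require Import boolp classical_sets cardinality reals.
From mathcomp Require Import complex.

Set Implicit Arguments.
Unset Strict Implicit.
Unset Printing Implicit Defensive.

Import GRing.Theory.
Local Open Scope classical_set_scope.
Local Open Scope ring_scope.

(* Projective k-dimensional flats of P(K^(n+1)), encoded as vector subspaces
   of K^(n+1) of dimension k+1. *)
Record flat (K : fieldType) (n k : nat) := Flat {
  flat_space :> {vspace 'rV[K]_n.+1};
  flat_dim : \dim flat_space == k.+1 }.

HB.instance Definition _ K n k := [isSub for @flat_space K n k].
HB.instance Definition _ K n k := [Choice of flat K n k by <:].

Notation point K n := (flat K n 0).
Notation line K n := (flat K n 1).
Notation plane K n := (flat K n 2).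

Definition represents (K : fieldType) (n : nat) (P : point K n)
    (v : 'rV[K]_n.+1) : Prop :=
  v != 0 /\ flat_space P = <[v]>%VS.

Definition collinear (K : fieldType) (n : nat) (P Q T : point K n) : Prop :=
  exists L : line K n, [/\ (P <= L)%VS, (Q <= L)%VS & (T <= L)%VS].

Definition spanned_planes (K : fieldType) (n : nat) (S : set (point K n)) :
    set (plane K n) :=
  [set H | exists P Q T, [/\ S P, S Q, S T, ~ collinear P Q T &
                             flat_space H = (P + Q + T)%VS]].

(* Meaningful for finite S only: fset_set is empty on infinite sets. *)
Definition f2 (K : fieldType) (n : nat) (S : set (point K n)) : nat :=
  #|` fset_set (spanned_planes S)|.

Definition std_basis (K : fieldType) (n : nat) (i : 'I_n.+1) : 'rV[K]_n.+1 :=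
  delta_mx 0 i.

(* When zeta ^+ 3 = 1, zeta ^+ a does not depend on the representative of
   a : 'Z_3, here the one in {0, 1, 2}. *)
Definition config (K : fieldType) (zeta : K) : set (point K 3) :=
  [set P | exists (i j : 'I_4) (a : 'Z_3),
    [/\ val i \in [:: 0; 1]%N, val j \in [:: 2; 3]%N &
        represents P (std_basis K i - zeta ^+ a *: std_basis K j)]].

(* Main.v *)
(** A plane spanned by S is determined by the set of points of S that it
    contains. Whether s lies in the span of p, q, r is the vanishing of a 4 x 4
    determinant over Z[zeta], which does not depend on the embedding of the
    Eisenstein integers in the ground field, and p, q, r are non-collinear iff
    some s in S makes this determinant nonzero, because S is not contained in
    a plane. The planes are therefore in bijection with the zero patterns,
    other than the full one, of the determinants det(s, p, q, r) as s runs over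
    S; these are enumerated by exact arithmetic in Z[zeta]. *)

From HB Require Import structures.
From mathcomp Require Import all_boot all_order all_algebra.
From mathcomp Require Import finmap ring zify.
From mathcomp Require Import boolp classical_sets cardinality reals complex.
Require Import Defs.

Set Implicit Arguments.
Unset Strict Implicit.
Unset Printing Implicit Defensive.
Import GRing.Theory Num.Theory.
Local Open Scope classical_set_scope.
Local Open Scope ring_scope.

(** * Eisenstein integers and their embeddings *)

(* [(a, b)] stands for [a + b * omega], where [omega ^+ 2 = - omega - 1]. *)
Definition eisenstein : Type := int * int.
HB.instance Definition _ := GRing.Zmodule.on eisenstein.

Definition eis_mul (x y : eisenstein) : eisenstein :=
  (x.1 * y.1 - x.2 * y.2, x.1 * y.2 + x.2 * y.1 - x.2 * y.2).

Fact eis_mulA : associative eis_mul.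
Proof. by move=> [a b] [c d] [e f]; congr pair => /=; ring. Qed.
Fact eis_mulC : commutative eis_mul.
Proof. by move=> [a b] [c d]; congr pair => /=; ring. Qed.
Fact eis_mul1 : left_id (1, 0) eis_mul.
Proof. by move=> [a b]; congr pair => /=; ring. Qed.
Fact eis_mulDl : left_distributive eis_mul +%R.
Proof. by move=> [a b] [c d] [e f]; congr pair => /=; ring. Qed.

HB.instance Definition _ := GRing.Zmodule_isComNzRing.Build eisenstein
  eis_mulA eis_mulC eis_mul1 eis_mulDl isT.

Definition omega : eisenstein := (0, 1).

Definition eis_conj (x : eisenstein) : eisenstein := (x.1 - x.2, - x.2).

Lemma eis_mul_conj (x : eisenstein) :
  x * eis_conj x = (x.1 ^+ 2 - x.1 * x.2 + x.2 ^+ 2)%:~R.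
Proof.
have natE (n : nat) : n%:R = (n%:Z, 0) :> eisenstein.
  by elim: n => // n IHn; rewrite mulrS IHn intS.
have intE (n : int) : n%:~R = (n, 0) :> eisenstein.
  case: n => n; first exact: natE.
  by rewrite NegzE mulrNz -pmulrn natE.
by rewrite intE; congr pair => /=; ring.
Qed.

(** If [f x = 0], the integer norm [x * eis_conj x] is also sent to 0, so it vanishes because [K]
    has characteristic 0; the form a^2 - ab + b^2 is positive definite. *)
Lemma eis_rmorphism_inj (K : numDomainType) (f : {rmorphism eisenstein -> K}) :
  injective f.
Proof.
suff f0 x : f x = 0 -> x = 0.
  by move=> x y fxy; apply/subr0_eq/f0; rewrite rmorphB fxy subrr.
move=> fx0; have: f (x * eis_conj x) = 0 by rewrite rmorphM fx0 mul0r.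
rewrite eis_mul_conj rmorph_int => /eqP; rewrite intr_eq0 => /eqP.
by case: x {fx0} => a b /= N0; congr pair; nia.
Qed.

Lemma eis_rmorphism_exists (K : comNzRingType) (zeta : K) :
  zeta ^+ 2 + zeta + 1 = 0 ->
  exists f : {rmorphism eisenstein -> K}, f omega = zeta.
Proof.
move=> zeta_root.
pose phi (x : eisenstein) := x.1%:~R + x.2%:~R * zeta.
have phiB : zmod_morphism phi.
  move=> [a b] [c d]; rewrite /phi /= !rmorphB; ring.
have phiM : monoid_morphism phi.
  split=> [|[a b] [c d]]; rewrite /phi /= ?mul0r ?addr0 //.
  rewrite !(rmorphB, rmorphD, rmorphM) /=.
  have zeta2 : zeta * zeta = - zeta - 1.
    by apply/subr0_eq; rewrite -zeta_root; ring.
  ring: zeta2.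
pose fB := GRing.isZmodMorphism.Build _ _ phi phiB.
pose fM := GRing.isMonoidMorphism.Build _ _ phi phiM.
pose f : {rmorphism eisenstein -> K} := HB.pack phi fB fM.
by exists f; rewrite /f /= /phi mul1r add0r.
Qed.

(** * Determinants, cardinality and linear algebra *)

(* Skipping zero entries makes the evaluation fast on sparse matrices. *)
Fixpoint laplace_det (A : pzRingType) (n : nat) (M : nat -> nat -> A) : A :=
  if n is n'.+1 then
    foldr (fun j s => if M 0%N j == 0 then s else
        M 0%N j * ((-1) ^+ j *
          laplace_det n' (fun i k => M i.+1 (bump j k))) + s)
      0 (iota 0 n)
  else 1.

Lemma laplace_detE (A : comPzRingType) (n : nat) (M : nat -> nat -> A) :
  laplace_det n M = \det (\matrix_(i < n, j < n) M i j).
Proof.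
elim: n M => [|n IHn] M; first by rewrite det_mx00.
transitivity (\sum_(0 <= j < n.+1)
  M 0%N j * ((-1) ^+ j * laplace_det n (fun i k => M i.+1 (bump j k)))).
  (* Unlocked, the big sum is the same right fold, up to the zero terms that [laplace_det] skips. *)
  rewrite unlock [LHS]/laplace_det -/laplace_det /reducebig /index_iota subn0.
  elim: (iota 0 n.+1) => //= j js ->.
  by case: eqP => // ->; rewrite mul0r add0r.
rewrite big_mkord (expand_det_row _ ord0); apply: eq_bigr => j _.
rewrite mxE /cofactor add0n IHn; congr (_ * (_ * \det _)).
by apply/matrixP => i k; rewrite !mxE.
Qed.

Lemma card_set_uniq_seq (T : choiceType) (s : seq T) :
  uniq s -> ([set` s] #= `I_(size s))%card.
Proof.
move=> s_uniq; have -> : [set` s] = [set` seq_fset tt s].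
  by apply/funext => x; rewrite /mkset seq_fsetE.
by apply/card_eq_fsetP; rewrite size_seq_fset undup_id.
Qed.

Lemma free_det (K : fieldType) (n : nat) (X : n.-tuple 'rV[K]_n) :
  free X = (\det (\matrix_i X`_i) != 0).
Proof.
rewrite -unitfE -unitmxE -row_free_unit.
have sumE (u : 'rV_n) : u *m \matrix_i X`_i = \sum_i u 0 i *: X`_i.
  by rewrite mulmx_sum_row; apply: eq_bigr => i _; rewrite rowK.
apply/freeP/idP => [X_free | X_free k].
  apply: inj_row_free => u; rewrite sumE => /X_free u0.
  by apply/rowP => i; rewrite u0 mxE.
move=> k0 i.
have: (\row_i k i) *m \matrix_i X`_i = (0 : 'rV_n) *m \matrix_i X`_i.
  by rewrite mul0mx sumE -[RHS]k0; apply: eq_bigr => l _; rewrite mxE.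
by move/(row_free_inj X_free)/rowP/(_ i); rewrite !mxE.
Qed.

(** A line has dimension exactly 2, while coinciding points span less: their span must be enlarged,
    one outside vector at a time, to give a line through them. *)
Lemma exists_supervspace (K : fieldType) (vT : vectType K) (U : {vspace vT})
    (k : nat) :
  (\dim U <= k <= \dim {:vT})%N ->
  exists2 W : {vspace vT}, (U <= W)%VS & \dim W = k.
Proof.
elim: k => [|k IHk] /andP[].
  by rewrite leqn0 => /eqP; exists U.
rewrite leq_eqVlt => /predU1P[dimU _ | leUk ltk]; first by exists U.
have [|W UW dimW] := IHk; first by rewrite -ltnS leUk ltnW.
have /subvPn[v _ vW] : ~~ ({:vT} <= W)%VS.
  by apply: contraTN ltk => /dimvS; rewrite dimW -leqNgt.
exists <<v :: vbasis W>>%VS.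
  by rewrite (subv_trans UW) // span_cons (span_basis (vbasisP W)) addvSr.
have : free (v :: vbasis W).
  by rewrite free_cons (span_basis (vbasisP W)) vW (basis_free (vbasisP W)).
by move/eqP=> -> /=; rewrite size_tuple dimW.
Qed.

Lemma not_collinearP (K : fieldType) (n : nat) (P Q T : point K n.+1)
    (p q r : 'rV[K]_n.+2) :
  flat_space P = <[p]>%VS -> flat_space Q = <[q]>%VS ->
  flat_space T = <[r]>%VS ->
  ~ collinear P Q T <-> free [:: p; q; r].
Proof.
move=> Pp Qq Tr; split=> [ncol | pqr_free [L [PL QL TL]]].
  rewrite /free eqn_leq dim_span /= ltnNge; apply/negP => dim_le2.
  have [|W] := @exists_supervspace _ _ <<[:: p; q; r]>>%VS 2.
    by rewrite dim_le2 dimvf /dim /= mul1n.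
  rewrite !span_cons span_nil addv0 !subv_add -Pp -Qq -Tr => /and3P[PW QW TW].
  by move=> /eqP dimW; apply: ncol; exists (Flat dimW).
have: (<<[:: p; q; r]>> <= L)%VS.
  by rewrite !span_cons span_nil addv0 !subv_add -Pp -Qq -Tr PL QL TL.
by move/dimvS; rewrite (eqP pqr_free) (eqP (flat_dim L)).
Qed.

(** * The configuration and its incidence masks *)

(* [(i, j, a)] stands for the point [e_i - zeta ^+ a e_j]. *)
Definition label : Type := nat * nat * nat.

Definition config_labels : seq label :=
  [seq (ij, a) | ij <- [seq (i, j) | i <- [:: 0; 1], j <- [:: 2; 3]],
                 a <- [:: 0; 1; 2]]%N.

Definition config_coord (t : label) (k : nat) : eisenstein :=
  if k == t.1.1 then 1 else if k == t.1.2 then - omega ^+ t.2 else 0.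

Definition config_vec (K : fieldType) (f : eisenstein -> K)
    (t : label) : 'rV[K]_4 :=
  \row_k f (config_coord t k).

Definition config_det (s p q r : label) : eisenstein :=
  laplace_det 4 (fun i => config_coord (nth s [:: s; p; q; r] i)).

(* When [p], [q], [r] are dependent, the mask is constantly [true]. *)
Definition span_mask (u : label * label * label) : bitseq :=
  [seq config_det s u.1.1 u.1.2 u.2 == 0 | s <- config_labels].

(** The filter drops the dependent triples, and [undup] merges triples that span the same plane. *)
Definition plane_masks : seq bitseq :=
  undup [seq m <- [seq span_mask u
    | u <- [seq (pq, r) | pq <- [seq (p, q) | p <- config_labels,
                                              q <- config_labels],
                          r <- config_labels]] | false \in m].

(** Exhaustive computation: 12^3 ordered triples, with 12 determinants each. *)
Lemma size_plane_masks : size plane_masks = 43%N.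
Proof. by vm_compute. Qed.

Lemma configP (K : fieldType) (f : {rmorphism eisenstein -> K})
    (P : point K 3) :
  config (f omega) P <->
  exists2 t, t \in config_labels & represents P (config_vec f t).
Proof.
(* [config_coord] tests the first index before the second, so the two sides agree only for distinct
   indices. *)
have vecE (i j : 'I_4) (a : nat) : i != j ->
    config_vec f (val i, val j, a) =
      std_basis K i - f omega ^+ a *: std_basis K j.
  move=> ij; apply/rowP => k; rewrite !mxE /config_coord /= -!val_eqE /=.
  case: eqP => [->|_]; first by rewrite val_eqE (negPf ij) mulr0 subr0 rmorph1.
  case: eqP => _; rewrite ?(mulr1, mulr0, sub0r, oppr0, rmorph0) //.
  by rewrite rmorphN rmorphXn.
have neq (i j : nat) : i \in [:: 0; 1]%N -> j \in [:: 2; 3]%N ->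
    [&& i < 4, j < 4 & i != j]%N.
  by rewrite !inE => /orP[] /eqP -> /orP[] /eqP ->.
split=> [[i [j [a [iI jI rep]]]] | [t]].
  have /and3P[_ _ ij] := neq _ _ iI jI.
  exists (val i, val j, val a); last by rewrite vecE.
  apply: allpairs_f; first exact: allpairs_f.
  by case: (a) => [[|[|[|]]]].
move=> /allpairsP[[ij a] [/allpairsP[[i j] [/= iI jI ->]] aI ->]].
have /and3P[i4 j4 ij'] := neq _ _ iI jI.
rewrite -(inordK i4) -(inordK j4) vecE -?val_eqE /= ?inordK // => rep.
exists (inord i), (inord j), (inord a); rewrite /= !inordK //.
by move: aI; rewrite !inE => /or3P[] /eqP ->.
Qed.

(** Ring morphisms commute with determinants, and [f] is injective, so a zero test in the Eisenstein
    integers decides dependence over [K]. *)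
Lemma config_det_eq0 (K : numFieldType) (f : {rmorphism eisenstein -> K})
    (s p q r : label) :
  (config_det s p q r == 0) =
    ~~ free [seq config_vec f t | t <- [:: s; p; q; r]].
Proof.
rewrite (free_det [tuple of [seq _ | t <- [tuple s; p; q; r]]]) negbK.
rewrite -(inj_eq (@eis_rmorphism_inj _ f)) rmorph0 /config_det laplace_detE.
rewrite -det_map_mx.
congr (\det _ == 0); apply/matrixP => i j; rewrite !mxE.
by rewrite (nth_map s) ?mxE.
Qed.

Definition config_mask (K : fieldType) (f : eisenstein -> K)
    (H : {vspace 'rV[K]_4}) : bitseq :=
  [seq config_vec f t \in H | t <- config_labels].

(** Adding a vector to a free family breaks freeness exactly when the vector lies in its span. *)
Lemma config_mask_span (K : numFieldType) (f : {rmorphism eisenstein -> K})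
    (p q r : label) :
  free [seq config_vec f t | t <- [:: p; q; r]] ->
  config_mask f <<[seq config_vec f t | t <- [:: p; q; r]]>> =
    span_mask (p, q, r).
Proof.
move=> pqr_free; apply: eq_map => s.
by rewrite (config_det_eq0 f) map_cons free_cons pqr_free andbT negbK.
Qed.

Lemma config_mask_plane (K : numFieldType) (f : {rmorphism eisenstein -> K})
    (H : plane K 3) :
  false \in config_mask f H.
Proof.
(* Four points spanning the whole space: the first two give e_0 and e_2, since omega differs from 1,
   and the others then give e_3 and e_1. *)
pose B := [:: (0, 2, 0); (0, 2, 1); (0, 3, 0); (1, 2, 0)]%N.
have B_free : free [seq config_vec f t | t <- B].
  by rewrite -[free _]negbK -config_det_eq0; vm_compute.
apply/negPn/negP => Hfull.
have: (<<[seq config_vec f t | t <- B]>> <= H)%VS.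
  apply/span_subvP => _ /mapP[t tB ->]; apply: contraNT Hfull => /negPf <-.
  apply: (map_f (fun t => config_vec f t \in flat_space H)).
  by apply/allP: t tB.
by move/dimvS; rewrite (eqP B_free) (eqP (flat_dim H)).
Qed.

(** * Counting the planes *)

Lemma f2_config (K : numFieldType) (f : {rmorphism eisenstein -> K}) :
  f2 (config (f omega)) = 43%N.
Proof.
pose v := config_vec f.
have spannedP (H : plane K 3) : spanned_planes (config (f omega)) H <->
    exists p q r,
    [/\ [/\ p \in config_labels, q \in config_labels & r \in config_labels],
      free (map v [:: p; q; r]) & flat_space H = <<map v [:: p; q; r]>>%VS].
  have spanE p q r :
      <<map v [:: p; q; r]>>%VS = (<[v p]> + <[v q]> + <[v r]>)%VS.
    by rewrite /= !span_cons span_nil addv0 addvA.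
  split=> [[P [Q [T [/configP[p pI [_ Pp]] /configP[q qI [_ Qq]]]]]] | ].
    move=> /configP[r rI [_ Tr]] /(not_collinearP Pp Qq Tr) pqr_free HE.
    by exists p, q, r; split=> //; rewrite spanE -Pp -Qq -Tr.
  move=> [p [q [r [[pI qI rI] pqr_free HE]]]].
  have pointP t : t \in config_labels -> t \in [:: p; q; r] ->
      exists2 P : point K 3, config (f omega) P & flat_space P = <[v t]>%VS.
    move=> tI /(map_f v)/(free_not0 pqr_free) vt0.
    have dimt : \dim <[v t]> == 1 by rewrite dim_vline vt0.
    by exists (Flat dimt) => //; apply/configP; exists t.
  have [|P SP Pp] := pointP p pI; first by rewrite !inE eqxx ?orbT.
  have [|Q SQ Qq] := pointP q qI; first by rewrite !inE eqxx ?orbT.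
  have [|T ST Tr] := pointP r rI; first by rewrite !inE eqxx ?orbT.
  exists P, Q, T; split=> //; first exact/(not_collinearP Pp Qq Tr).
  by rewrite HE spanE Pp Qq Tr.
pose mask (H : plane K 3) := config_mask f H.
(* A spanned plane is generated by points of S, and equal masks put these generators in the other
   plane; symmetry gives equality. *)
have mask_inj : {in spanned_planes (config (f omega)) &, injective mask}.
  suff sub H H' : spanned_planes (config (f omega)) H -> mask H = mask H' ->
      (H <= H')%VS.
    move=> H H' /set_mem SH /set_mem SH' eqm; apply/val_inj/eqP.
    by rewrite eqEsubv !sub.
  move=> /spannedP[p [q [r [[pI qI rI] _ HE]]]] /eq_in_map eqm.
  rewrite HE; apply/span_subvP => _ /mapP[t tX ->].
  rewrite -eqm; first by rewrite HE memv_span ?map_f.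
  by apply/allP: t tX; apply/and4P; split.
have mask_image :
    mask @` spanned_planes (config (f omega)) = [set` plane_masks].
  apply/seteqP; split=> m /=.
    move=> [H /spannedP[p [q [r [[pI qI rI] pqr_free HE]]]] <-].
    rewrite mem_undup mem_filter config_mask_plane /mask HE config_mask_span //.
    rewrite andTb.
    apply: (map_f span_mask); apply: allpairs_f => //; exact: allpairs_f.
  rewrite mem_undup mem_filter => /andP[mF /mapP[u]].
  move=> /allpairsP[[pq r] [/allpairsP[[p q] [/= pI qI ->]] /= rI ->]] mE.
  (* A [false] entry yields [s] independent of [p], [q], [r], so these three are themselves free and
     span a plane. *)
  have /mapP[s sI /esym] : false \in span_mask (p, q, r) by rewrite -mE.
  rewrite (config_det_eq0 f) => /negbFE.
  rewrite map_cons free_cons => /andP[_ pqr_free].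
  exists (Flat pqr_free); last by rewrite mE -(config_mask_span pqr_free).
  by apply/spannedP; exists p, q, r.
apply/card_fset_set/(card_eq_trans (card_esym (inj_card_eq mask_inj))).
rewrite mask_image -size_plane_masks.
exact/card_set_uniq_seq/undup_uniq.
Qed.

Theorem lemma5p3 (R : realType) (zeta : R[i])
    (zeta_prim : 3.-primitive_root zeta) :
  f2 (config zeta) = 43%N.
Proof.
have zeta_root : zeta ^+ 2 + zeta + 1 = 0.
  have /eqP : (zeta - 1) * (zeta ^+ 2 + zeta + 1) = 0.
    transitivity (zeta ^+ 3 - 1); first by ring.
    by rewrite prim_expr_order // subrr.
  rewrite mulf_eq0 subr_eq0 => /orP[/eqP z1|/eqP //].
  (* If [zeta] were 1, its powers 1 and 0 would agree, forcing 1 = 0 modulo 3. *)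
  by have := eq_prim_root_expr zeta_prim 1 0; rewrite z1 !expr1n eqxx.
have [f <-] := eis_rmorphism_exists zeta_root; exact: f2_config.
Qed.
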